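(* Let $\Sigma$ be a finite alphabet and let $L\subseteq\Sigma^*$ be a language recognized with bounded error by some affine finite automaton over $\Sigma$ (i.e. $L\in\mathsf{BAfL}$). Then there exists an affine finite automaton $\mathcal{A}$ over $\Sigma$ such that $f_{\mathcal{A}}(w)\ge\frac34$ for all $w\in L$, and $f_{\mathcal{A}}(w)\le\frac14$ for all $w\in\Sigma^*\setminus L$.
   Context: A real vector is affine if its coordinates sum to $1$; a real square matrix is affine if each of its columns is an affine vector. An affine finite automaton (AfA) over a finite alphabet $\Sigma$ is a tuple $A = (E, \Sigma, \{M_x\}_{x\in\Sigma}, \vec{v}_0, E_a)$, where $E=\{e_1,\dots,e_k\}$ is a finite set of states, each $M_x$ is a $k\times k$ real affine matrix, $\vec{v}_0\in\mathbb{R}^k$ is an affine vector (the initial state), and $E_a\subseteq E$ is the set of accepting states. For $w = w_1\cdots w_n\in\Sigma^*$ put $M_w = M_{w_n}\cdots M_{w_1}$ (the identity if $w$ is the empty word) and $\vec{v}_f = M_w\vec{v}_0$. The function $f_A:\Sigma^*\to[0,1]$ computed by $A$ is $$f_A(w) = \frac{\sum_{e_i\in E_a} |(\vec{v}_f)_i|}{\sum_{e_i\in E} |(\vec{v}_f)_i|}.$$ A language $L\subseteq\Sigma^*$ is recognized by $A$ with bounded error if there exists $\varepsilon$ with $0<\varepsilon<\frac12$ such that $f_A(w)\ge 1-\varepsilon$ for all $w\in L$ and $f_A(w)\le\varepsilon$ for all $w\in\Sigma^*\setminus L$. $\mathsf{BAfL}$ denotes the class of languages recognized with bounded error by some AfA.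 *)

(* Defs.v *)
From HB Require Import structures.
From mathcomp Require Import all_boot all_order all_algebra.
From mathcomp Require Import classical_sets reals.

Set Implicit Arguments.
Unset Strict Implicit.
Unset Printing Implicit Defensive.

Import Order.TTheory GRing.Theory Num.Theory.
Local Open Scope ring_scope.

Definition affine_vec (R : realType) (k : nat) (v : 'cV[R]_k) : Prop :=
  \sum_(i < k) v i ord0 = 1.

Definition affine_mx (R : realType) (k : nat) (M : 'M[R]_k) : Prop :=
  forall j : 'I_k, affine_vec (col j M).

(* The states e_1, ..., e_k are the elements of ['I_k] with [k = nstates].
   Since no vector of length 0 is affine, [init_affine] forces [0 < nstates]. *)
Record AfA (R : realType) (Sigma : finType) := MkAfA {
  nstates : nat;
  trans : Sigma -> 'M[R]_nstates;
  init : 'cV[R]_nstates;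
  accepting : {set 'I_nstates};
  trans_affine : forall x : Sigma, affine_mx (trans x);
  init_affine : affine_vec init
}.

(* [word_mx A [:: w_1; ...; w_n]] is M_{w_n} * ... * M_{w_1}: the first letter
   acts first, hence is the rightmost factor. *)
Fixpoint word_mx (R : realType) (Sigma : finType) (A : AfA R Sigma)
    (w : seq Sigma) : 'M[R]_(nstates A) :=
  if w is x :: w' then word_mx A w' *m trans A x else 1%:M.

Definition final_vec (R : realType) (Sigma : finType) (A : AfA R Sigma)
    (w : seq Sigma) : 'cV[R]_(nstates A) :=
  word_mx A w *m init A.

(* The denominator is nonzero because [final_vec A w] is affine, so the
   convention [0^-1 = 0] never comes into play. *)
Definition accept_value (R : realType) (Sigma : finType) (A : AfA R Sigma)
    (w : seq Sigma) : R :=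
  (\sum_(i in accepting A) `|final_vec A w i ord0|)
    / (\sum_(i < nstates A) `|final_vec A w i ord0|).

Definition recognizes_bounded_error (R : realType) (Sigma : finType)
    (A : AfA R Sigma) (L : set (seq Sigma)) : Prop :=
  exists eps : R,
    [/\ 0 < eps < 2^-1,
        forall w : seq Sigma, L w -> 1 - eps <= accept_value A w
      & forall w : seq Sigma, ~ L w -> accept_value A w <= eps].

Definition BAfL (R : realType) (Sigma : finType) (L : set (seq Sigma)) : Prop :=
  exists A : AfA R Sigma, recognizes_bounded_error A L.
Arguments BAfL R {Sigma} L.

(* Main.v *)
Require Import Defs.
From mathcomp Require Import all_boot all_order all_algebra.
From mathcomp Require Import classical_sets reals.
From mathcomp Require Import ring lra.
Local Open Scope ring_scope.
Import Order.TTheory GRing.Theory Num.Theory.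

(** Absolute values are multiplicative, so three tensored copies of an AfA whose
accepting states are the triples with at least two accepting components compute
[3 p ^ 2 - 2 p ^ 3] where the original automaton computes [p]. This map commutes
with [p |-> 1 - p], and on [[0, e]] with [e < 1/2] it contracts towards [0] by
the factor [3 e - 2 e ^ 2 = 1 - (1 - e) (1 - 2 e) < 1]; hence finitely many
iterations push both error bounds below [1/4]. *)

Section Automata.
Variables (R : realType) (Sigma : finType).
Implicit Types (A : AfA R Sigma) (w : seq Sigma).

Lemma sum_mulmx_affine k (M : 'M[R]_k) (v : 'cV[R]_k) :
  affine_mx M -> \sum_i (M *m v) i ord0 = \sum_i v i ord0.
Proof.
move=> affM; under eq_bigr do rewrite mxE.
rewrite exchange_big; apply: eq_bigr => j _ /=.
rewrite -mulr_suml; have := affM j; rewrite /affine_vec.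
by under eq_bigr do rewrite mxE; move=> ->; rewrite mul1r.
Qed.

Lemma final_vec_affine A w : affine_vec (final_vec A w).
Proof.
(* The vector is generalized because the first letter acts first, so the induction on the word
   changes the starting vector. *)
suff sumE (v : 'cV_(nstates A)) :
    \sum_i (word_mx A w *m v) i ord0 = \sum_i v i ord0.
  rewrite /affine_vec sumE; exact: init_affine.
elim: w v => [|x w IHw] v /=; first by rewrite mul1mx.
by rewrite -mulmxA IHw; apply: sum_mulmx_affine; apply: trans_affine.
Qed.

(** By the triangle inequality the sum is at least the absolute value of the coordinate sum, which
    is 1. *)
Lemma final_norm_gt0 A w : 0 < \sum_i `|final_vec A w i ord0|.
Proof.
apply: lt_le_trans (ler_norm_sum _ _ _).
by rewrite (final_vec_affine A w) normr1.
Qed.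

Lemma accept_value_ge0 A w : 0 <= accept_value A w.
Proof. by rewrite divr_ge0 // sumr_ge0. Qed.

Lemma accept_value_le1 A w : accept_value A w <= 1.
Proof.
rewrite /accept_value ler_pdivrMr ?final_norm_gt0// mul1r.
rewrite [leRHS](bigID (mem (accepting A))) /= lerDl.
by rewrite sumr_ge0.
Qed.

Section Cube.
Variable k : nat.

Definition triple : finType := ('I_k * 'I_k * 'I_k)%type.
(** States of an AfA are ordinals, so triples of states are reached through their enumeration. *)
Definition dec (i : 'I_#|triple|) : triple := enum_val i.
Implicit Type i : 'I_#|triple|.

Lemma sum_triple (f g h : 'I_k -> R) :
  \sum_i f (dec i).1.1 * g (dec i).1.2 * h (dec i).2 =
  (\sum_j f j) * (\sum_j g j) * (\sum_j h j).
Proof.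
rewrite -(big_enum_val (A := triple) (fun t => f t.1.1 * g t.1.2 * h t.2)) /=.
rewrite big_distrlr pair_bigA /= big_distrlr /= pair_bigA /=.
by apply: eq_bigl.
Qed.

(** The Kronecker cube of [M]; [mul_cube] is the mixed-product rule. *)
Definition cube_mx (M : 'M[R]_k) : 'M[R]_#|triple| :=
  \matrix_(i, j) (M (dec i).1.1 (dec j).1.1 * M (dec i).1.2 (dec j).1.2
                  * M (dec i).2 (dec j).2).

Definition cube_vec (v : 'cV[R]_k) : 'cV[R]_#|triple| :=
  \col_i (v (dec i).1.1 ord0 * v (dec i).1.2 ord0 * v (dec i).2 ord0).

Lemma mul_cube M v : cube_mx M *m cube_vec v = cube_vec (M *m v).
Proof.
apply/matrixP => i j; rewrite !mxE -sum_triple.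
by apply: eq_bigr => l _; rewrite !mxE; ring.
Qed.

Lemma cube_vec_affine v : affine_vec v -> affine_vec (cube_vec v).
Proof.
rewrite /affine_vec => v1; under eq_bigr do rewrite mxE.
by rewrite (sum_triple (v^~ ord0) (v^~ ord0) (v^~ ord0)) v1 !mulr1.
Qed.

Lemma cube_mx_affine M : affine_mx M -> affine_mx (cube_mx M).
Proof.
move=> affM j; rewrite /affine_vec; under eq_bigr do rewrite !mxE.
rewrite (sum_triple (M^~ _) (M^~ _) (M^~ _)).
have sum1 l : \sum_i M i l = 1.
  by rewrite -(affM l); apply: eq_bigr => i _; rewrite mxE.
by rewrite !sum1 !mulr1.
Qed.

End Cube.

Definition majority_states k (E : {set 'I_k}) : {set 'I_#|triple k|} :=
  [set i | let: (a, b, c) := dec _ i in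
           [|| (a \in E) && (b \in E), (b \in E) && (c \in E)
             | (a \in E) && (c \in E)]].

Definition majority A : AfA R Sigma :=
  MkAfA (majority_states _ (accepting A))
        (fun x => cube_mx_affine _ _ (trans_affine (a := A) x))
        (cube_vec_affine _ _ (init_affine A)).

Definition maj3 (p : R) : R := 3 * p ^+ 2 - 2 * p ^+ 3.

Lemma final_majority A w : final_vec (majority A) w = cube_vec _ (final_vec A w).
Proof.
rewrite /final_vec /=; elim: w (init A) => [|x w IHw] v /=.
  by rewrite !mul1mx.
by rewrite -!mulmxA mul_cube IHw.
Qed.

Lemma accept_majority A w : accept_value (majority A) w = maj3 (accept_value A w).
Proof.
have s_gt0 := final_norm_gt0 A w.
rewrite /accept_value final_majority.
set v := final_vec A w in s_gt0 *.
set s : R := \sum_(i < nstates A) `|v i ord0| in s_gt0 *.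
set a : R := \sum_(i in accepting A) `|v i ord0|.
pose f i : R := `|v i ord0|; pose g i : R := if i \in accepting A then f i else 0.
have gE : \sum_i g i = a by rewrite /a [RHS]big_mkcond.
have -> : \sum_(i < nstates (majority A)) `|cube_vec _ v i ord0| = s * s * s.
  by rewrite -(sum_triple _ f f f); apply: eq_bigr => i _; rewrite mxE !normrM.
have -> : \sum_(i in accepting (majority A)) `|cube_vec _ v i ord0|
  = 3 * a ^+ 2 * s - 2 * a ^+ 3.
  (* For truth values [x], [y], [z] in {0, 1}, the majority is [x y + y z + x z - 2 x y z]; each
     monomial factors over the three copies, giving [a] for a constrained copy and [s] for a free
     one. *)
  transitivity (a * a * s + s * a * a + a * s * a - 2 * (a * a * a)); last by ring.
  rewrite -gE -[s]/(\sum_i f i) -!sum_triple mulr_sumr -!big_split -sumrB /=.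
  rewrite [LHS]big_mkcond; apply: eq_bigr => i _.
  rewrite mxE !normrM inE /g -!/(f _); case: (dec _ i) => [[x y] z] /=.
  by do 3 case: (_ \in accepting A) => /=; ring.
by rewrite /maj3; field; rewrite gt_eqF.
Qed.

Lemma accept_iter_majority n A w :
  accept_value (iter n majority A) w = iter n maj3 (accept_value A w).
Proof. by elim: n => //= n <-; rewrite accept_majority. Qed.

(** Reduces the bound for accepted words, near 1, to the one near 0. *)
Lemma iter_maj3_compl n p : iter n maj3 (1 - p) = 1 - iter n maj3 p.
Proof. by elim: n => //= n ->; rewrite /maj3; ring. Qed.

Lemma iter_maj3_le (e p : R) n : 0 <= p <= e -> e < 2^-1 ->
  0 <= iter n maj3 p <= (3 * e - 2 * e ^+ 2) ^+ n * e.
Proof.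
move=> /andP[p0 pe] e2; have e0 : 0 <= e by apply: le_trans pe.
have c01 : 0 <= 3 * e - 2 * e ^+ 2 <= 1 by apply/andP; split; nra.
elim: n => [|n /andP[q0 qle]] /=; first by rewrite p0 expr0 mul1r.
set q := iter n maj3 p in q0 qle *.
have qe : q <= e.
  apply: le_trans qle _; case/andP: c01 => c0 c1.
  by rewrite ler_piMl// exprn_ile1.
have -> : maj3 q = (3 * q - 2 * q ^+ 2) * q by rewrite /maj3; ring.
have r0 : 0 <= 3 * q - 2 * q ^+ 2 by nra.
rewrite mulr_ge0//= [_ ^+ n.+1]exprS -mulrA ler_pM//.
(* The right side minus the left is [(e - q) * (3 - 2 * (e + q))], and [e + q < 1]. *)
by nra.
Qed.

Lemma exists_expr_le (c b : R) : 0 <= c < 1 -> 0 < b ->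
  exists n, c ^+ n <= b.
Proof.
move=> /andP[c0 c1] b0.
(* Bernoulli's inequality in a form without division by [c], which may be 0. The induction step
   loses exactly [(n + 1) * (1 - c) ^ 2] in the second factor. *)
have bernoulli n : c ^+ n * (1 + n%:R * (1 - c)) <= 1.
  elim: n => [|n IHn]; first by rewrite expr0 mul0r addr0 mulr1.
  apply: le_trans IHn; rewrite exprSr -mulrA ler_wpM2l ?exprn_ge0//.
  have : 0 <= (n%:R + 1) * (1 - c) ^+ 2 by rewrite mulr_ge0 ?sqr_ge0 ?addr_ge0.
  by rewrite -natr1; lra.
have x0 : 0 <= (b * (1 - c))^-1 by rewrite invr_ge0 mulr_ge0 ?subr_ge0 ?ltW.
(* This [n] makes [n * b * (1 - c) > 1], so [c ^ n > b] would contradict [bernoulli]. *)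
exists (Num.bound (b * (1 - c))^-1).
have := archi_boundP x0; move: (Num.bound _) => n.
rewrite -div1r ltr_pdivrMr ?mulr_gt0 ?subr_gt0// => n_big.
have := bernoulli n; have : 0 <= c ^+ n by rewrite exprn_ge0.
set y := c ^+ n => y0 ybound.
rewrite leNgt; apply/negP => yb.
have : 0 <= (y - b) * (n%:R * (1 - c)) by rewrite !mulr_ge0 ?subr_ge0 ?(ltW yb) ?(ltW c1).
lra.
Qed.

End Automata.

Theorem proposition9 (R : realType) (Sigma : finType) (L : set (seq Sigma))
    (hL : BAfL R L) :
  exists A : AfA R Sigma,
    (forall w : seq Sigma, L w -> 3 / 4 <= accept_value A w) /\
    (forall w : seq Sigma, ~ L w -> accept_value A w <= 1 / 4).
Proof.
case: hL => A [e [/andP[e0 e2] accL rejL]].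
have c01 : 0 <= 3 * e - 2 * e ^+ 2 < 1 by apply/andP; split; nra.
have [|n cn] := exists_expr_le R _ (1 / 4) c01; first by lra.
have small (p : R) : 0 <= p <= e -> iter n (maj3 R) p <= 1 / 4.
  move=> pe; have /andP[_ le_n] := iter_maj3_le R e p n pe e2.
  by apply: le_trans le_n _; nra.
exists (iter n (majority R Sigma) A); split=> w Lw; rewrite accept_iter_majority.
  (* For a word of [L] it is the rejection value that lies in [[0, e]]. *)
  have := small (1 - accept_value A w); rewrite iter_maj3_compl.
  have := accept_value_le1 _ _ A w; have := accL w Lw.
  move=> ge_w le1 /(_ _); rewrite subr_ge0 le1 /= => /(_ ltac:(lra)); lra.
by apply: small; rewrite accept_value_ge0 rejL.
Qed.
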